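(* Let $m,q,L,t,s$ be positive integers with $1\le t\le L\le s\le m$. Consider the $(L,K,\Gamma,M,N)$ multiaccess coded caching system with access topology $\mathfrak{B}$, where $([\Gamma],\mathfrak{G},\mathfrak{B})$ is a $t$-$(m,q,L,1)$ GDD with $\Gamma=mq$ (so $K=|\mathfrak{B}|=\binom{m}{t}q^t/\binom{L}{t}$). If there exists an $\mathrm{OA}(m,q,s)$, then the following memory-load tradeoff point is achievable: $$(M,R)=\left(\frac{\left(q^s-(q-1)^Lq^{s-L}\right)\binom{L}{t}}{q^s\binom{L}{t}}\,N,\ \frac{q^{m-s}(q-1)^t}{\binom{L}{t}}\right).$$
   Context: Notation: $[n]=\{1,\dots,n\}$. Group divisible design. For positive integers $L,t,q,m$ with $t\le L\le m$, a $t$-$(m,q,L,\lambda)$ GDD is a triple $(\mathcal{X},\mathfrak{G},\mathfrak{B})$ where $\mathcal{X}$ is a set of $mq$ points; $\mathfrak{G}=\{\mathcal{G}_1,\dots,\mathcal{G}_m\}$ is a partition of $\mathcal{X}$ into $m$ subsets (groups) of size $q$; and $\mathfrak{B}$ is a family of $L$-subsets of $\mathcal{X}$ (blocks) such that every block meets every group in at most one point, and every $t$-subset of points from $t$ distinct groups belongs to exactly $\lambda$ blocks. Orthogonal array. For positive integers $m$, $q\ge2$ and $s\le m$, an $\mathrm{OA}_\lambda(m,q,s)$ is a $\lambda q^s\times m$ matrix with entries in $[q]$ such that, in every choice of $s$ columns, each vector of $[q]^s$ appears as a row exactly $\lambda$ times; $\mathrm{OA}(m,q,s)$ means $\lambda=1$.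 Multiaccess coded caching system. A server has $N$ files of equal length; there are $\Gamma$ cache-nodes $C_1,\dots,C_\Gamma$, each with a cache of size $M$ files, where the model takes $0\le M\le N/L$, and $K\le N$ cacheless users. The access topology $\mathfrak{B}=\{\mathcal{B}_1,\dots,\mathcal{B}_K\}$ consists of distinct $L$-subsets of $[\Gamma]$; user $k$ can read the full content of exactly the cache-nodes $C_\gamma$ with $\gamma\in\mathcal{B}_k$. An $F$-division scheme has two phases. Placement: each file is divided into $F$ packets of equal size, and each cache-node stores at most $MF$ packets of files, without knowledge of the later requests. Delivery: each user requests one file; given the request vector $\mathbf{d}\in[N]^K$, the server broadcasts over an error-free shared link $S_{\mathbf{d}}$ coded packets (each of the size of one packet) to all users, such that each user can recover its requested file from the broadcast and the contents of the cache-nodes it can access. The (worst-case) load is $R=\max_{\mathbf{d}\in[N]^K}S_{\mathbf{d}}/F$. A memory-load point $(M,R)$ is achievable if there is such a scheme with cache-node size $M$ and load at most $R$. *)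

(* Defs.v *)
From mathcomp Require Import all_boot all_order all_algebra.

Set Implicit Arguments.
Unset Strict Implicit.
Unset Printing Implicit Defensive.

Import Order.TTheory GRing.Theory Num.Theory.
Local Open Scope ring_scope.

Definition transverse (X : finType) (groups : {set {set X}}) (A : {set X}) :=
  forall G : {set X}, G \in groups -> (#|A :&: G| <= 1)%N.

(* A t-(m, q, L, lambda) group divisible design. Blocks are an indexed family,
   so repeated blocks count with multiplicity. *)
Record is_gdd (t m q L lambda K : nat) (X : finType)
    (groups : {set {set X}}) (B : 'I_K -> {set X}) : Prop := IsGdd {
  gdd_range : [/\ 0 < t, t <= L, L <= m & 0 < q]%N;
  gdd_points : #|X| = (m * q)%N;
  gdd_partition : partition groups [set: X];
  gdd_groups : #|groups| = m;
  gdd_group_size : forall G, G \in groups -> #|G| = q;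
  gdd_block_size : forall k, #|B k| = L;
  gdd_block_transverse : forall k, transverse groups (B k);
  gdd_balanced : forall T : {set X}, #|T| = t -> transverse groups T ->
    #|[set k | T \subset B k]| = lambda
}.

(* An orthogonal array OA_lambda(m, q, s); the alphabet [q] is 'I_q and a choice
   of s columns is an injection c. *)
Record is_oa (lambda m q s : nat) (A : 'M['I_q]_(lambda * q ^ s, m)) : Prop :=
  IsOa {
  oa_range : [/\ 0 < s, s <= m & 1 < q]%N;
  oa_balanced : forall c : 'I_s -> 'I_m, injective c ->
    forall v : 'rV['I_q]_s, #|[set r | row r (colsub c A) == v]| = lambda
}.

Definition packet (l : nat) := 'rV['F_2]_l.

Definition file (F l : nat) := {ffun 'I_F -> packet l}.

Definition library (N F l : nat) := {ffun 'I_N -> file F l}.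

Definition request (N K : nat) := {ffun 'I_K -> 'I_N}.

(* Node g stores the packets (n, j) in Z g, where (n, j) is packet j of file n. *)
Definition placement (N F Gamma : nat) := 'I_Gamma -> {set 'I_N * 'I_F}.

(* What can be read from a set of cache-nodes: None marks the packets stored in
   none of them. *)
Definition content (N F l : nat) := {ffun 'I_N * 'I_F -> option (packet l)}.

Definition read_nodes (N F Gamma l : nat) (Z : placement N F Gamma)
    (W : library N F l) (nodes : {set 'I_Gamma}) : content N F l :=
  [ffun p => if p \in \bigcup_(g in nodes) Z g then Some (W p.1 p.2) else None].

Definition is_topology (L K Gamma : nat) (B : 'I_K -> {set 'I_Gamma}) : Prop :=
  injective B /\ forall k, #|B k| = L.

(* An F-division scheme. The placement and the numbers S_d of transmissions do
   not depend on the packet length l in bits, and the scheme must work for every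
   l; coding is otherwise arbitrary. The request vector is known to the server
   and to all users during delivery, but not to the placement. *)
Record scheme (N F K Gamma : nat) (B : 'I_K -> {set 'I_Gamma}) := Scheme {
  cache : placement N F Gamma;
  transmissions : request N K -> nat;
  encode : forall (l : nat) (d : request N K),
    library N F l -> (transmissions d).-tuple (packet l);
  decode : forall (l : nat) (d : request N K), 'I_K ->
    (transmissions d).-tuple (packet l) -> content N F l -> file F l;
  decodeP : forall (l : nat) (d : request N K) (k : 'I_K) (W : library N F l),
    decode k (encode d W) (read_nodes cache W (B k)) = W (d k)
}.

Definition load (N F K Gamma : nat) (B : 'I_K -> {set 'I_Gamma})
    (sch : scheme N F B) : rat :=
  (\max_(d : request N K) transmissions sch d)%:R / F%:R.

(* No upper bound is imposed on the cache size M: the model range M <= N / L is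
   a restriction on the points one looks at, not on the notion of a scheme. *)
Definition achievable (N K Gamma : nat) (B : 'I_K -> {set 'I_Gamma})
    (M R : rat) : Prop :=
  exists (F : nat) (sch : scheme N F B),
    [/\ (0 < F)%N,
        forall g, #|cache sch g|%:R <= M * F%:R &
        load sch <= R].

(* Main.v *)
Require Import Defs.
From mathcomp Require Import all_boot all_order all_algebra.
From mathcomp Require Import perm ring.
Import Order.TTheory GRing.Theory Num.Theory.
Local Open Scope ring_scope.

(** The points of the design are coordinatized as pairs (column i, symbol a), and
    node (i, a) caches the packets (r, j) of each file such that row r of the
    orthogonal array has entry a in column i; here j indexes the t-subsets S of
    a block. User k lacks (r, j) exactly when row r avoids its block in every
    column. Such a request is labelled by the word e obtained from row r by
    writing the symbols of S in the columns of S, together with the overwritten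
    entries, which differ from the new ones: there are q^m (q-1)^t labels, and
    one sum is sent per label. If two requests share a label, then either their
    sets S occupy the same columns, and the requests coincide because a t-subset
    lies in one block only, or some point of S lies in a column where row r' of
    the other request agrees with e, so that this point caches r'. A node stores
    a fraction 1/q of the library; the claimed M is the fraction
    1 - ((q-1)/q)^L that a user can read, which is at least 1/q. *)

(** * Coded delivery from a labelling of the requests *)

(** User [k] recovers a missing [p] from the sum labelled [label k p]: by the hypothesis on labels
    it can read every other summand, hence subtract it. *)
Lemma achievable_labelled (N K Gamma : nat) (B : 'I_K -> {set 'I_Gamma})
    (P I : finType) (stored : 'I_Gamma -> {set P}) (label : 'I_K -> P -> I)
    (M R : rat) :
  let read k := \bigcup_(g in B k) stored g in
  (0 < #|P|)%N ->
  (forall k p k' p', p \notin read k -> p' \notin read k' ->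
     label k p = label k' p' -> p' \notin read k -> (k', p') = (k, p)) ->
  (forall g, (N * #|stored g|)%:R <= M * #|P|%:R) ->
  #|I|%:R / #|P|%:R <= R ->
  achievable N B M R.
Proof.
move=> read P0 lab_inj memM loadR.
pose Z : placement N #|P| Gamma := fun g => [set x | enum_val x.2 \in stored g].
have readE k n p : ((n, enum_rank p) \in \bigcup_(g in B k) Z g) = (p \in read k).
  by apply/bigcupP/bigcupP => -[g Bg H]; exists g => //; move: H;
     rewrite inE /= enum_rankK.
pose others k p (x : 'I_K * P) :=
  [&& x.2 \notin read x.1, label x.1 x.2 == label k p & x != (k, p)].
pose enc l (d : request N K) (W : library N #|P| l) : #|I|.-tuple (packet l) :=
  [tuple \sum_(x : 'I_K * P | (x.2 \notin read x.1)
           && (label x.1 x.2 == enum_val i)) W (d x.1) (enum_rank x.2) | i < #|I|].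
pose dec l (d : request N K) k (Y : #|I|.-tuple (packet l))
    (C : content N #|P| l) : file #|P| l :=
  [ffun j => let p := enum_val j in
     if C (d k, j) is Some w then w else
     tnth Y (enum_rank (label k p)) -
     \sum_(x | others k p x) odflt 0 (C (d x.1, enum_rank x.2))].
have decK l d k (W : library N #|P| l) :
  dec l d k (enc l d W) (read_nodes Z W (B k)) = W (d k).
  apply/ffunP => j; rewrite ffunE -(enum_valK j) !enum_rankK; move: (enum_val j) => p.
  rewrite ffunE readE; case: ifPn => // kp.
  rewrite /= /enc tnth_mktuple enum_rankK (bigD1 (k, p)) /=; last by rewrite kp eqxx.
  rewrite (eq_bigl (others k p)); last by move=> x; rewrite /others andbA.
  apply/eqP; rewrite subr_eq; apply/eqP; congr (_ + _).
  apply: eq_bigr => -[k' p'] /and3P[/= kp' /eqP El ne].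
  rewrite ffunE readE; case: ifPn => // np.
  by case/eqP: ne; apply: lab_inj.
exists #|P|, (@Scheme N #|P| K Gamma B Z (fun=> #|I|) enc dec decK); split=> //.
  move=> g /=; apply: le_trans (memM g); rewrite ler_nat.
  have -> : Z g = setX setT [set j | enum_val j \in stored g].
    by apply/setP => x; rewrite !inE.
  rewrite cardsX cardsT card_ord leq_mul2l -(card_imset _ enum_val_inj).
  apply/orP; right; apply: subset_leq_card; apply/subsetP => p /imsetP[j].
  by rewrite inE => ? ->.
rewrite /load /=; apply: le_trans loadR.
rewrite ler_wpM2r ?invr_ge0 ?ler0n // ler_nat.
by apply/bigmax_leqP.
Qed.

(** * Coordinates of points and counting of transverse sets *)

(** [col x] is the rank of the group of [x] in [enum P], and [sym x] the rank of [x] inside that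
    group. *)
Lemma partition_coordinates {X : finType} {m q : nat} {P : {set {set X}}} :
  partition P [set: X] -> #|P| = m -> (forall G, G \in P -> #|G| = q) ->
  exists (col : X -> 'I_m) (sym : X -> 'I_q),
    injective (fun x => (col x, sym x)) /\
    forall A : {set X}, transverse P A <-> {in A &, injective col}.
Proof.
move=> /and3P[/eqP covP tivP P0] cardP cardG.
have covx x : x \in cover P by rewrite covP inE.
have Px x : pblock P x \in P by rewrite pblock_mem.
have xP x : x \in pblock P x by rewrite mem_pblock.
have colP x : (index (pblock P x) (enum P) < m)%N.
  by rewrite -cardP cardE index_mem mem_enum.
have symP x : (index x (enum (pblock P x)) < q)%N.
  by rewrite -(cardG _ (Px x)) cardE index_mem mem_enum.
have idxE (T : finType) (A : {set T}) (a b : T) :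
    a \in A -> b \in A -> index a (enum A) = index b (enum A) -> a = b.
  by move=> Aa Ab /(index_inj a); apply; rewrite mem_enum.
have colE x y : Ordinal (colP x) = Ordinal (colP y) -> pblock P x = pblock P y.
  by move=> [/idxE]; apply.
exists (fun x => Ordinal (colP x)), (fun x => Ordinal (symP x)); split.
  move=> x y Exy; have /colE Eb := congr1 fst Exy.
  have /= Es := congr1 (fun z => val z.2) Exy.
  by rewrite Eb in Es; apply: idxE Es; rewrite // -Eb.
move=> A; split=> [trA x y Ax Ay /colE Exy | injA G PG].
  apply/eqP; move: (trA _ (Px x)); rewrite leqNgt; apply: contraR => nxy.
  by apply/card_gt1P; exists x, y; rewrite !inE Ax Ay xP {1}Exy xP.
rewrite leqNgt; apply/card_gt1P => -[x [y []]]; rewrite !inE.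
move=> /andP[Ax Gx] /andP[Ay Gy] /eqP[]; apply: injA => //; apply: val_inj => /=.
by rewrite (def_pblock tivP PG Gx) (def_pblock tivP PG Gy).
Qed.

(** Such a set is the graph of a partial function from columns to symbols, encoded with values in
    [option 'I_q]: choose the support, then a symbol in each of its columns. *)
Lemma card_partial_sections {X : finType} {m q : nat} (t : nat)
    {col : X -> 'I_m} {sym : X -> 'I_q} :
  bijective (fun x => (col x, sym x)) ->
  #|[set A : {set X} | dinjectiveb col A & #|A| == t]| = ('C(m, t) * q ^ t)%N.
Proof.
case=> pt ptK Kpt.
pose isS := [pred o : option 'I_q | isSome o].
(* Since values on [D] must lie in [isS], the support is exactly [D], not merely contained in it. *)
pose PF (D : {set 'I_m}) : pred {ffun 'I_m -> option 'I_q} :=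
  pffun_on None (mem D) isS.
have cardS : #|isS| = q.
  have -> : #|isS| = #|codom (@Some 'I_q)|.
    apply: eq_card => -[a|]; rewrite !inE; first by rewrite codom_f.
    by apply/esym/codomP => -[].
  by rewrite card_codom ?card_ord // => ? ? [].
have sup (f : {ffun 'I_m -> option 'I_q}) (D : {set 'I_m}) :
  (f \in PF D) = (D == [set i | isSome (f i)]).
  apply/pffun_onP/eqP => [[/subsetP suf imf] | ->].
    apply/setP => i; rewrite inE; apply/idP/idP => [Di | fi].
      by have := imf (f i); rewrite inE; apply; apply: map_f; rewrite mem_enum.
    by apply: suf; rewrite inE; case: (f i) fi.
  split; first by apply/subsetP => i; rewrite !inE; case: (f i).
  by move=> o /imageP[i]; rewrite !inE => ? ->.
pose graph (f : {ffun 'I_m -> option 'I_q}) := [set x | f (col x) == Some (sym x)].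
have graphP f i a : (pt (i, a) \in graph f) = (f i == Some a).
  by rewrite inE; case: (Kpt (i, a)) => -> ->.
have graph_inj : injective graph.
  move=> f g E; apply/ffunP => i; have H a : (f i == Some a) = (g i == Some a).
    by rewrite -!graphP E.
  case Ef: (f i) => [a|]; first by have := H a; rewrite Ef eqxx => /esym/eqP.
  by case Eg: (g i) => [a|] //; have := H a; rewrite Ef Eg eqxx.
have supE (f : {ffun 'I_m -> option 'I_q}) : [set i | isSome (f i)] = col @: graph f.
  apply/setP => i; rewrite inE; apply/idP/imsetP => [|[x]]; last first.
    by rewrite inE => /eqP Ef ->; rewrite Ef.
  case Ef: (f i) => [a|] // _; exists (pt (i, a)); first by rewrite graphP Ef.
  by case: (Kpt (i, a)) => ->.
have -> : [set A : {set X} | dinjectiveb col A & #|A| == t]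
    = graph @: [set f : {ffun 'I_m -> option 'I_q} | #|[set i | isSome (f i)]| == t].
  apply/setP => A; rewrite inE; apply/andP/imsetP => [[/dinjectiveP injA cA] | [f]].
    pose f := [ffun i => omap sym [pick x in A | col x == i]].
    have Af : A = graph f.
      apply/setP => x; rewrite inE ffunE; case: pickP => [y /andP[Ay /eqP Ey] | Nx] /=.
        apply/idP/eqP => [Ax | [Es]]; first by rewrite (injA y x).
        by have -> : x = y by apply: (can_inj ptK); rewrite Ey Es.
      by apply/negP => Ax; have := Nx x; rewrite Ax eqxx.
    by exists f => //; rewrite inE supE -Af card_in_imset.
  rewrite inE supE => ct ->; have injf : {in graph f &, injective col}.
    move=> x y; rewrite !inE => /eqP Ex /eqP Ey Exy; apply: (can_inj ptK).
    by rewrite Exy in Ex *; move: Ex; rewrite Ey => -[->].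
  by split; [apply/dinjectiveP | rewrite card_in_imset in ct].
rewrite card_imset // -sum1_card.
rewrite (partition_big (fun f : {ffun 'I_m -> option 'I_q} => [set i | isSome (f i)])
           (fun D => #|D| == t)) /=; last by move=> f; rewrite inE.
rewrite (eq_bigr (fun=> q ^ t)%N) => [|D /eqP cD].
  by rewrite sum_nat_const -[X in 'C(X, _)]card_ord -card_draws cardsE.
have <- : #|PF D| = (q ^ t)%N by rewrite card_pffun_on cardS cD.
rewrite sum1_card.
apply: eq_card => f; rewrite unfold_in /= sup inE andbC eq_sym.
by case: eqP => //= <-; rewrite cD eqxx.
Qed.

(** * Blocks of the design *)

Section GroupDivisible.

Context {t m q L K : nat} {X : finType} {groups : {set {set X}}}
        {B : 'I_K -> {set X}}.
Hypothesis gdd : is_gdd t m q L 1 groups B.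

Lemma gdd_coordinates :
  exists (col : X -> 'I_m) (sym : X -> 'I_q),
    bijective (fun x => (col x, sym x)) /\
    forall A : {set X}, transverse groups A <-> {in A &, injective col}.
Proof.
have [col [sym [inj trE]]] := partition_coordinates (gdd_partition gdd)
  (gdd_groups gdd) (gdd_group_size gdd).
exists col, sym; split=> //; apply: inj_card_bij inj _.
by rewrite card_prod !card_ord (gdd_points gdd).
Qed.

Lemma gdd_block_unique (T : {set X}) (k k' : 'I_K) :
  #|T| = t -> T \subset B k -> T \subset B k' -> k = k'.
Proof.
move=> cT Tk Tk'; have trT : transverse groups T.
  by move=> G /(gdd_block_transverse gdd k); apply: leq_trans;
     rewrite subset_leq_card ?setSI.
have /eqP/cards1P[k0 Ek0] := gdd_balanced gdd cT trT.
have H i : T \subset B i -> i = k0.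
  by move=> Ti; apply/set1P; rewrite -Ek0 inE.
by rewrite (H k) // (H k').
Qed.

(** Double counting of the pairs of a transverse [t]-subset and a block containing it. *)
Lemma gdd_card_blocks : (K * 'C(L, t) = 'C(m, t) * q ^ t)%N.
Proof.
have [col [sym [bij trE]]] := gdd_coordinates.
rewrite -(card_partial_sections t bij) -sum1_card.
have tr1 (T : {set X}) : T \in [set A : {set X} | dinjectiveb col A & #|A| == t] ->
    (1 = \sum_(k | T \subset B k) 1)%N.
  rewrite inE => /andP[/dinjectiveP/trE trT /eqP cT].
  by rewrite -[LHS](gdd_balanced gdd cT trT) -sum1_card; apply: eq_bigl => k; rewrite inE.
rewrite (eq_bigr _ tr1) (exchange_big_dep xpredT) //=.
rewrite -[K in LHS]card_ord -sum_nat_const; apply: eq_bigr => k _.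
rewrite -(gdd_block_size gdd k) -cards_draws -sum1_card.
apply: eq_bigl => T; rewrite !inE [RHS]andbAC; congr (_ && _).
case Tk: (T \subset B k); rewrite ?andbF // andbT; symmetry; apply/dinjectiveP.
move=> x y Tx Ty; apply: (proj1 (trE _) (gdd_block_transverse gdd k));
  exact: (subsetP Tk).
Qed.

End GroupDivisible.

(** * Orthogonal arrays and arithmetic of the alphabet *)

(** The first [s] columns already determine a row. *)
Lemma oa_row_inj {m q s : nat} {A : 'M['I_q]_(1 * q ^ s, m)} :
  is_oa A -> forall r r', A r =1 A r' -> r = r'.
Proof.
move=> oa r r' Err; have [_ sm _] := oa_range oa.
have inj_c : injective (widen_ord sm) by move=> i j [/val_inj].
have /eqP/cards1P[r0 Er0] := oa_balanced oa inj_c (row r (colsub (widen_ord sm) A)).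
have H r1 : A r =1 A r1 -> r1 = r0.
  by move=> E; apply/set1P; rewrite -Er0 inE; apply/eqP/rowP => j; rewrite !mxE E.
by rewrite (H r) // (H r').
Qed.

(** Once the entry in column [i] is fixed, [s - 1] further columns determine the row. *)
Lemma oa_card_symbol {m q s : nat} {A : 'M['I_q]_(1 * q ^ s, m)} (i : 'I_m) (a : 'I_q) :
  is_oa A -> (#|[set r | A r i == a]| <= q ^ s.-1)%N.
Proof.
case: s A => [|s] A oa; have [// _ sm _] := oa_range oa.
(* The transposition puts [i] first and keeps the columns distinct even if [i] is already one of the
   first [s]. *)
pose c j := tperm (widen_ord sm ord0) i (widen_ord sm j).
have inj_c : injective c by move=> j j' /perm_inj [/val_inj].
have c0 : c ord0 = i by rewrite /c tpermL.
pose tail r : 'rV['I_q]_s := \row_j A r (c (lift ord0 j)).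
have inj_t : {in [set r | A r i == a] &, injective tail}.
  move=> r r'; rewrite !inE => /eqP Er /eqP Er' Et.
  have /eqP/cards1P[r0 Er0] := oa_balanced oa inj_c (row r (colsub c A)).
  have H r1 : A r1 i = a -> tail r = tail r1 -> r1 = r0.
    move=> E /rowP Et1; apply/set1P; rewrite -Er0 inE; apply/eqP/rowP => j.
    rewrite !mxE; case: (unliftP ord0 j) => [j' ->|->]; last by rewrite c0 E.
    by have := Et1 j'; rewrite !mxE => ->.
  by rewrite (H r) // (H r').
rewrite -(card_in_imset inj_t); apply: leq_trans (max_card _) _.
by rewrite card_mx card_ord mul1n.
Qed.

(** [diff a] numbers the [q - 1] symbols other than [a], whence the factor [q - 1] per overwritten
    entry in the count of labels. *)
Lemma symbol_difference {q : nat} : (1 < q)%N ->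
  exists diff : 'I_q -> 'I_q -> 'I_q.-1,
    forall a b b', b != a -> b' != a -> diff a b = diff a b' -> b = b'.
Proof.
case: q => [|[|q]] // _; exists (fun a b : 'I_q.+2 => odflt ord0 (unlift a b)) => a b b'.
rewrite eq_sym => /unlift_some[c -> ->]; rewrite eq_sym => /unlift_some[c' -> ->] /=.
by move=> ->.
Qed.

(** After splitting [q ^ s] as [q ^ s.-1] plus [q - 1] times [q ^ s.-1], it reduces to [q - 1 <= q]
    raised to the power [L - 1]. *)
Lemma avoiding_words_bound (q L s : nat) : (0 < q)%N -> (0 < L)%N -> (L <= s)%N ->
  (q ^ s.-1 + q.-1 ^ L * q ^ (s - L) <= q ^ s)%N.
Proof.
case: q L s => [|q] [|L] [|s] // _ _; rewrite subSS ltnS /= => Ls.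
rewrite (expnS q.+1) mulSn leq_add2l expnS -mulnA leq_mul2l -{2}(subnKC Ls) expnD leq_mul2r.
by apply/or3P/Or33; case: (posnP L) => [-> | L0]; rewrite ?expn0 ?leq_exp2r.
Qed.

(** * The labelling and the resulting memory-load point *)

Theorem theorem2 (m q L t s N K Gamma : nat)
    (groups : {set {set 'I_Gamma}}) (B : 'I_K -> {set 'I_Gamma})
    (hq : (0 < q)%N) (ht : (1 <= t)%N) (htL : (t <= L)%N)
    (hLs : (L <= s)%N) (hsm : (s <= m)%N)
    (hGamma : Gamma = (m * q)%N) (hKN : (K <= N)%N)
    (htop : is_topology L B)
    (hgdd : is_gdd t m q L 1 groups B)
    (hoa : exists A : 'M['I_q]_(1 * q ^ s, m), is_oa A) :
  K%:R = ('C(m, t) * q ^ t)%N%:R / 'C(L, t)%:R :> rat /\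
  achievable N B
    ((q%:R ^+ s - (q%:R - 1) ^+ L * q%:R ^+ (s - L)%N) * 'C(L, t)%:R
       / (q%:R ^+ s * 'C(L, t)%:R) * N%:R)
    (q%:R ^+ (m - s)%N * (q%:R - 1) ^+ t / 'C(L, t)%:R).
Proof.
case: hoa => A oa; have [s0 _ q1] := oa_range oa.
have [col [sym [/bij_inj bij trE]]] := gdd_coordinates hgdd.
have C0 : (0 < 'C(L, t))%N by rewrite bin_gt0.
have C0' : 'C(L, t)%:R != 0 :> rat by rewrite pnatr_eq0 -lt0n.
split; first by rewrite -(gdd_card_blocks hgdd) natrM mulfK.
have [diff diffP] := symbol_difference q1.
pose draws k := [set S : {set 'I_Gamma} | S \subset B k & #|S| == t].
have size_draws k : size (enum (draws k)) = 'C(L, t).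
  by rewrite -cardE cards_draws (gdd_block_size hgdd).
(* Numbering the [t]-subsets of every block by the same index set makes the packet indices
   independent of the user. *)
pose sub k (j : 'I_('C(L, t))) := nth set0 (enum (draws k)) j.
have subP k j : sub k j \subset B k /\ #|sub k j| = t.
  have : sub k j \in enum (draws k) by rewrite mem_nth ?size_draws.
  by rewrite mem_enum inE => /andP[-> /eqP].
have sub_inj k : injective (sub k).
  move=> j j' /eqP; rewrite nth_uniq ?size_draws ?enum_uniq //.
  by move=> /eqP/val_inj.
have col_inj k j : {in sub k j &, injective col}.
  move=> x y Sx Sy; apply: (proj1 (trE _) (gdd_block_transverse hgdd k));
  exact: (subsetP (proj1 (subP k j))).
pose i0 : 'I_m := Ordinal (leq_trans s0 hsm).
pose P := ('I_(1 * q ^ s) * 'I_('C(L, t)))%type.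
pose word k (p : P) : {ffun 'I_m -> 'I_q} :=
  [ffun i => if [pick x in sub k p.2 | col x == i] is Some x then sym x else A p.1 i].
(* Listing the columns of [sub k p.2] in the order of [enum] lets all users share one type of gaps;
   there are [t] columns, so the default [i0] is never reached. *)
pose gaps k (p : P) : {ffun 'I_t -> 'I_q.-1} :=
  [ffun a : 'I_t => let i := nth i0 (enum (col @: sub k p.2)) a in
                    diff (word k p i) (A p.1 i)].
have word_in k (p : P) x : x \in sub k p.2 -> word k p (col x) = sym x.
  move=> Sx; rewrite ffunE; case: pickP => [y /andP[Sy /eqP Eyx]|/(_ x)].
    by rewrite (col_inj _ _ _ _ Sy Sx Eyx).
  by rewrite Sx eqxx.
have word_out k (p : P) i : i \notin col @: sub k p.2 -> word k p i = A p.1 i.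
  move=> Ni; rewrite ffunE; case: pickP => // x /andP[Sx /eqP Ei].
  by rewrite -Ei imset_f in Ni.
have card_cols k j : #|col @: sub k j| = t.
  by rewrite card_in_imset ?(proj2 (subP k j)) //; apply: col_inj.
have cardP : #|{: P}| = (q ^ s * 'C(L, t))%N by rewrite card_prod !card_ord mul1n.
have q10 : q%:R - 1 = q.-1%:R :> rat by rewrite -subn1 natrB.
have Q0 n : q%:R ^+ n != 0 :> rat by rewrite expf_neq0 // pnatr_eq0 -lt0n.
apply: (@achievable_labelled _ _ _ _ P ({ffun 'I_m -> 'I_q} * {ffun 'I_t -> 'I_q.-1})%type
  (fun g => [set p : P | A p.1 (col g) == sym g]) (fun k p => (word k p, gaps k p))).
- by rewrite cardP muln_gt0 expn_gt0 hq.
- have unread k (p : P) : p \notin \bigcup_(g in B k) [set p : P | A p.1 (col g) == sym g] ->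
      forall x, x \in B k -> A p.1 (col x) != sym x.
    by move=> /bigcupP np x Bx; apply: contra_notN np => Ax; exists x; rewrite ?inE.
  move=> k p k' p' /unread np _ [Ew Eg] /unread np'.
  (* Otherwise the common word shows the row of [p'] in the column of some [x] of block [k], so [x]
     caches [p']. *)
  have sub_cols : col @: sub k p.2 \subset col @: sub k' p'.2.
    apply/subsetP => _ /imsetP[x Sx ->]; apply: contraT => /word_out Ex.
    by have := np' x (subsetP (proj1 (subP k _)) _ Sx); rewrite -Ex -Ew word_in ?eqxx.
  have Ecols : col @: sub k p.2 = col @: sub k' p'.2.
    by apply/eqP; rewrite eqEcard sub_cols !card_cols leqnn.
  have ES : sub k p.2 = sub k' p'.2.
    apply/eqP; rewrite eqEcard (proj2 (subP k _)) (proj2 (subP k' _)) leqnn andbT.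
    apply/subsetP => x Sx; have /imsetP[y Sy Exy] := subsetP sub_cols _ (imset_f col Sx).
    suff -> : x = y by [].
    by apply: bij; rewrite Exy -(word_in _ _ _ Sx) -(word_in _ _ _ Sy) Ew Exy.
  have Ek : k = k'.
    apply: (gdd_block_unique hgdd _ _ _ (proj2 (subP k p.2)) (proj1 (subP k p.2))).
    by rewrite ES; case: (subP k' p'.2).
  subst k'; move/sub_inj: ES => Ej.
  suff Er : p'.1 = p.1 by case: p p' Er Ej {Ew Eg np np' sub_cols Ecols} => ? ? [? ?] /= -> ->.
  (* Outside the columns of [S] the word shows the row itself; inside, both rows differ from the
     common symbol, so equal gaps give equal entries. *)
  apply: (oa_row_inj oa) => i; have [Ci | Ni] := boolP (i \in col @: sub k p.2); last first.
    by rewrite -!(word_out k) ?Ew // -Ecols.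
  have lt_i : (index i (enum (col @: sub k p.2)) < t)%N.
    by have := card_cols k p.2; rewrite cardE => {2}<-; rewrite index_mem mem_enum.
  have := congr1 (fun f : {ffun 'I_t -> 'I_q.-1} => f (Ordinal lt_i)) Eg.
  rewrite !ffunE /= -Ecols nth_index ?mem_enum // -/(word k p) Ew.
  case/imsetP: Ci => x Sx ->; have Bx := subsetP (proj1 (subP k _)) _ Sx.
  by move=> E; apply/esym; apply: (diffP _ _ _ _ _ E); rewrite -Ew word_in ?np ?np'.
- move=> g; apply: (@le_trans _ _ (N * (q ^ s.-1 * 'C(L, t)))%N%:R).
    rewrite ler_nat leq_mul2l; apply/orP; right.
    have -> : [set p : P | A p.1 (col g) == sym g]
        = setX [set r | A r (col g) == sym g] setT.
      by apply/setP => p; rewrite !inE andbT.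
    by rewrite cardsX cardsT card_ord leq_mul2r oa_card_symbol ?orbT.
  rewrite cardP [X in _ <= X](_ : _ =
    N%:R * ((q%:R ^+ s - (q%:R - 1) ^+ L * q%:R ^+ (s - L)%N) * 'C(L, t)%:R)); last first.
    by rewrite natrM natrX; field; rewrite C0' Q0.
  rewrite natrM ler_wpM2l ?ler0n // natrM ler_wpM2r ?ler0n //.
  rewrite q10 -!natrX -natrM lerBrDr -natrD ler_nat.
  exact: avoiding_words_bound hq (leq_trans ht htL) hLs.
(* Writing [m] as [(m - s) + s] lets the number of rows [q ^ s] cancel. *)
- rewrite cardP card_prod !card_ffun !card_ord !natrM !natrX q10 -{1}(subnK hsm) exprD.
  by rewrite le_eqVlt; apply/orP; left; apply/eqP; field; rewrite C0' Q0.
Qed.
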